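(* Let $k$ be an algebraically closed field of characteristic zero and let $q\in k$ with $q^i\neq1$ for every nonzero integer $i$. Let $f\in k(t,x)$ be such that, over the algebraic closure $\overline{k(t)}$ of $k(t)$, $$f=c+\sum_{i=1}^m\sum_{j=1}^{n_i}\frac{\alpha_{i,j}}{(x-\beta_i)^j},$$ where $c\in k(t)$, $\alpha_{i,j},\beta_i\in\overline{k(t)}$, $\alpha_{i,n_i}\neq 0$ for each $i$, and the $\beta_i$ lie in distinct $q^{\mathbb{Z}}$-orbits (i.e. there is no $i\neq i'$ and $n\in\mathbb{Z}$ with $\beta_i=q^n\beta_{i'}$). Then there exist a nonzero operator $L\in k(t)\langle S_t\rangle$ and $g\in k(t,x)$ with $L(f)=\Delta_{q,x}(g)$ if and only if all the $\beta_i$ lie in $k$.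
   Context: $S_t(h(t,x))=h(t+1,x)$; $Q_x(h(t,x))=h(t,qx)$ and $\Delta_{q,x}=Q_x-1$. $k(t)\langle S_t\rangle$ is the ring of operators $\sum_\ell e_\ell S_t^\ell$ with $e_\ell\in k(t)$, acting on $k(t,x)$. *)

(* Defs.v *)
From HB Require Import structures.
From mathcomp Require Import all_boot all_order all_algebra.
Set Implicit Arguments.
Unset Strict Implicit.
Unset Printing Implicit Defensive.
Import GRing.Theory.
Local Open Scope ring_scope.
Local Open Scope quotient_scope.

Notation "x %:F" := (@FracField.tofrac _ x) : ring_scope.

(* The field F(X) of rational functions; k(t) is [ratF k] and k(t, x) is
   modelled as k(t)(x), that is [ratF (ratF k)]. *)
Notation ratF F := {fraction {poly F}}.

(* The map p / d |-> phi p / phi d.  It is independent of the chosen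
   representative when phi is an injective ring morphism (fracmap_div). *)
Definition fracmap (R S : idomainType) (phi : R -> S) (u : {fraction R}) :
    {fraction S} :=
  (phi \n_(repr u))%:F / (phi \d_(repr u))%:F.

Section FracmapTheory.
Variables (R S : idomainType) (phi : {rmorphism R -> S}).
Hypothesis phiI : injective phi.

Lemma frac_numden (u : {fraction R}) :
  u = (\n_(repr u))%:F / (\d_(repr u))%:F.
Proof.
have d0 : (\d_(repr u))%:F != 0 :> {fraction R} by rewrite tofrac_eq0 denom_ratioP.
apply: (mulIf d0); rewrite divfK // -{1}[u]reprK.
rewrite -[LHS]/(FracField.mul _ _); unlock FracField.tofrac.
rewrite -FracField.pi_mul; apply/eqmodP; rewrite /= FracField.equivfE.
rewrite /FracField.mulf !numden_Ratio ?mulr1 ?oner_neq0 ?denom_ratioP //.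
by rewrite mulrC.
Qed.

Lemma fracmap_div (a b : R) :
  b != 0 -> fracmap phi (a%:F / b%:F) = (phi a)%:F / (phi b)%:F.
Proof.
move=> b0; rewrite /fracmap; set u := a%:F / b%:F.
have phi0 c : c != 0 -> (phi c)%:F != 0 :> {fraction S}.
  by rewrite tofrac_eq0 -(rmorph0 phi) (inj_eq phiI).
have dn0 := denom_ratioP (repr u); apply/eqP.
rewrite eqr_div ?phi0 ?dn0 //.
rewrite -!tofracM -!rmorphM tofrac_eq (inj_eq phiI).
rewrite -tofrac_eq !tofracM -eqr_div ?tofrac_eq0 //.
by rewrite -frac_numden.
Qed.

Lemma fracmap_tofrac (a : R) : fracmap phi a%:F = (phi a)%:F.
Proof.
by rewrite -[a%:F]divr1 -tofrac1 fracmap_div ?oner_neq0 // rmorph1 tofrac1 divr1.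
Qed.

Lemma fracmapD : {morph fracmap phi : u v / u + v}.
Proof.
move=> u v; rewrite (frac_numden u) (frac_numden v).
have phi0 (w : {fraction R}) : (phi \d_(repr w))%:F != 0 :> {fraction S}.
  by rewrite tofrac_eq0 -(rmorph0 phi) (inj_eq phiI) denom_ratioP.
rewrite addf_div ?tofrac_eq0 ?denom_ratioP // -!tofracM -tofracD.
rewrite !fracmap_div ?mulf_neq0 ?denom_ratioP //.
by rewrite addf_div // -!tofracM -tofracD rmorphD !rmorphM.
Qed.

Lemma fracmapM : {morph fracmap phi : u v / u * v}.
Proof.
move=> u v; rewrite (frac_numden u) (frac_numden v).
rewrite mulf_div -!tofracM !fracmap_div ?mulf_neq0 ?denom_ratioP //.
by rewrite mulf_div -!tofracM !rmorphM.
Qed.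

End FracmapTheory.

(* h(t) |-> h(t + 1) on k(t), and h(t, x) |-> h(t + 1, x) on k(t, x). *)
Definition shift (k : fieldType) : ratF k -> ratF k :=
  fracmap (fun p : {poly k} => p \Po ('X + 1)).
Definition shift_t (k : fieldType) : ratF (ratF k) -> ratF (ratF k) :=
  fracmap (map_poly (@shift k)).

(* h(t, x) |-> h(t, q x). *)
Definition dilate_x (k : fieldType) (q : k) : ratF (ratF k) -> ratF (ratF k) :=
  fracmap (fun p : {poly ratF k} => p \Po (q%:P%:F *: 'X)).

Definition delta_qx (k : fieldType) (q : k) (h : ratF (ratF k)) :
    ratF (ratF k) :=
  dilate_x q h - h.

(* An element of k(t)<S_t> is encoded by its coefficient sequence: L stands for
   sum_l L`_l S_t^l.  Only the left k(t)-module structure of {poly k(t)} is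
   meaningful here, its commutative product is not that of k(t)<S_t>. *)
Notation shift_op k := {poly ratF k}.
Definition op_act (k : fieldType) (L : shift_op k) (h : ratF (ratF k)) :
    ratF (ratF k) :=
  \sum_(l < size L) (L`_l)%:P%:F * iter l (@shift_t k) h.

(* The map E(x) -> K(x) extending a field morphism E -> K. *)
Definition ratF_ext (E K : fieldType) (iota : E -> K) : ratF E -> ratF K :=
  fracmap (map_poly iota).

(* Main.v *)
Require Import Defs.
From HB Require Import structures.
From mathcomp Require Import all_boot all_order all_algebra.
From mathcomp Require Import boolp.
Set Implicit Arguments.
Unset Strict Implicit.
Unset Printing Implicit Defensive.
Import GRing.Theory.
Local Open Scope ring_scope.

(* If L(f) = Q(g) - g with L_0 <> 0 and beta is a nonzero pole of f, then, because
   f has no other pole on the orbit q^Z beta and because Q(g) - g cannot have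
   exactly one pole on a q-orbit, some q^z beta is a pole of S^l(f) with l > 0.
   In terms of minimal polynomials over k(t): q^z beta is a root of S^l(p') for
   the minimal polynomial p' of some pole beta'. If beta' is constant then so
   is beta. Otherwise, starting from a non-constant pole of maximal degree, the
   degrees stay equal, so S^l(p')(q^z x) is proportional to p; finiteness of the
   set of poles closes a cycle, along which every coefficient u of p satisfies
   S^l(u) = b u with l > 0 and b in k. Hence u is in k, and beta too, as k is
   algebraically closed.
   Conversely, if the poles are constant then f = A / P with P in k[x], and the
   deg(A) + 2 polynomials S^l(A), l <= deg(A) + 1, are linearly dependent over
   k(t), which yields an L with L(f) = 0. *)

(** * Ring morphisms between fraction fields *)

Section Fracmap.
Variables (R S : idomainType) (phi : {rmorphism R -> S}).

Lemma fracmap_zmod_morphism : injective phi -> zmod_morphism (fracmap phi).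
Proof.
move=> phiI u v; rewrite fracmapD //; congr (_ + _); apply/eqP.
rewrite -subr_eq0 opprK -fracmapD // addNr -tofrac0.
by rewrite fracmap_tofrac // rmorph0 tofrac0.
Qed.

Lemma fracmap_monoid_morphism : injective phi -> monoid_morphism (fracmap phi).
Proof.
move=> phiI; split; last exact: fracmapM.
by rewrite -tofrac1 fracmap_tofrac // rmorph1 tofrac1.
Qed.

End Fracmap.

Lemma frac_rmorph_eq (R : idomainType) (F : fieldType)
    (A B : {rmorphism {fraction R} -> F}) :
  (forall a : R, A a%:F = B a%:F) -> A =1 B.
Proof. by move=> AB u; rewrite (frac_numden u) !fmorph_div !AB. Qed.

Section TofracDiv.
Variable R : idomainType.
Implicit Types a b c d : R.

Lemma tofrac_divD a b c d : b != 0 -> d != 0 ->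
  a%:F / b%:F + c%:F / d%:F = (a * d + c * b)%:F / (b * d)%:F.
Proof. by move=> b0 d0; rewrite addf_div ?tofrac_eq0 // tofracD !tofracM. Qed.

Lemma tofrac_divM a b c d :
  (a%:F / b%:F) * (c%:F / d%:F) = (a * c)%:F / (b * d)%:F.
Proof. by rewrite mulf_div !tofracM. Qed.

Lemma tofrac_div_eq a b c d : b != 0 -> d != 0 ->
  a%:F / b%:F = c%:F / d%:F <-> a * d = c * b.
Proof.
move=> b0 d0; split=> [/eqP|e]; last apply/eqP;
  rewrite eqr_div ?tofrac_eq0 // -!tofracM ?e // tofrac_eq.
by move/eqP.
Qed.

End TofracDiv.

Lemma comp_poly_addK (R : comNzRingType) (a : R) :
  cancel (fun p : {poly R} => p \Po ('X + a%:P)) (fun p => p \Po ('X - a%:P)).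
Proof.
by move=> p; rewrite -comp_polyA comp_polyD comp_polyX comp_polyC addrNK comp_polyXr.
Qed.

Lemma comp_poly_subK (R : comNzRingType) (a : R) :
  cancel (fun p : {poly R} => p \Po ('X - a%:P)) (fun p => p \Po ('X + a%:P)).
Proof. by move=> p; have := comp_poly_addK (- a) p; rewrite polyCN opprK. Qed.

Lemma comp_poly_scaleK (R : fieldType) (a : R) (p : {poly R}) :
  a != 0 -> (p \Po (a *: 'X)) \Po (a^-1 *: 'X) = p.
Proof.
move=> a0; rewrite -comp_polyA comp_polyZ comp_polyX scalerA divff //.
by rewrite scale1r comp_polyXr.
Qed.

(** * The shift of k(t) and its inverse *)

Section Shift.
Variable k : fieldType.

(** The inverse of [shift], by which a left factor S_t of an operator is later cancelled. *)
Definition shiftN : ratF k -> ratF k :=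
  fracmap (fun p : {poly k} => p \Po ('X - 1)).

Lemma comp_shift_inj : injective (fun p : {poly k} => p \Po ('X + 1)).
Proof. by rewrite -polyC1; apply: can_inj (@comp_poly_addK _ 1). Qed.

Lemma comp_shiftN_inj : injective (fun p : {poly k} => p \Po ('X - 1)).
Proof. by rewrite -polyC1; apply: can_inj (@comp_poly_subK _ 1). Qed.

HB.instance Definition _ := GRing.isZmodMorphism.Build _ _ (@shift k)
  (fracmap_zmod_morphism (phi := comp_poly ('X + 1)) comp_shift_inj).
HB.instance Definition _ := GRing.isMonoidMorphism.Build _ _ (@shift k)
  (fracmap_monoid_morphism (phi := comp_poly ('X + 1)) comp_shift_inj).
HB.instance Definition _ := GRing.isZmodMorphism.Build _ _ shiftN
  (fracmap_zmod_morphism (phi := comp_poly ('X - 1)) comp_shiftN_inj).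
HB.instance Definition _ := GRing.isMonoidMorphism.Build _ _ shiftN
  (fracmap_monoid_morphism (phi := comp_poly ('X - 1)) comp_shiftN_inj).

Lemma shift_tofrac (p : {poly k}) : shift p%:F = (p \Po ('X + 1))%:F.
Proof. exact: (fracmap_tofrac (phi := comp_poly ('X + 1)) comp_shift_inj). Qed.

Lemma shiftN_tofrac (p : {poly k}) : shiftN p%:F = (p \Po ('X - 1))%:F.
Proof. exact: (fracmap_tofrac (phi := comp_poly ('X - 1)) comp_shiftN_inj). Qed.

Lemma shiftNK : cancel (@shift k) shiftN.
Proof.
apply: (frac_rmorph_eq (A := shiftN \o @shift k) (B := idfun)) => p /=.
by rewrite shift_tofrac shiftN_tofrac -polyC1 (comp_poly_addK 1).
Qed.

Lemma shiftC (b : k) : shift b%:P%:F = b%:P%:F.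
Proof. by rewrite shift_tofrac comp_polyC. Qed.

End Shift.

(** * Extension of the coefficient field from E to K *)

Section RatFExt.
Variables (E K : fieldType) (iota : {rmorphism E -> K}).

Lemma map_poly_rmorph_inj : injective (map_poly iota).
Proof. exact: map_inj_poly (fmorph_inj iota) (rmorph0 iota). Qed.

HB.instance Definition _ := GRing.isZmodMorphism.Build _ _ (ratF_ext iota)
  (fracmap_zmod_morphism map_poly_rmorph_inj).
HB.instance Definition _ := GRing.isMonoidMorphism.Build _ _ (ratF_ext iota)
  (fracmap_monoid_morphism map_poly_rmorph_inj).

Lemma ratF_ext_tofrac (p : {poly E}) : ratF_ext iota p%:F = (map_poly iota p)%:F.
Proof. exact: fracmap_tofrac map_poly_rmorph_inj _. Qed.

Lemma ratF_ext_div (u v : {poly E}) : ratF_ext iota (u%:F / v%:F) =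
  (map_poly iota u)%:F / (map_poly iota v)%:F.
Proof. by rewrite -!ratF_ext_tofrac; apply: fmorph_div. Qed.

(** Divisibility of polynomials does not change under field extension: the denominator of [h]
    divides its numerator over K, hence over E. *)
Lemma ratF_ext_poly (h : ratF E) (A : {poly K}) :
  ratF_ext iota h = A%:F -> exists B : {poly E}, h = B%:F.
Proof.
rewrite (frac_numden h); have := denom_ratioP (repr h).
move: (\n_(repr h)) (\d_(repr h)) => u v v0.
have iv0 : map_poly iota v != 0 by rewrite map_poly_eq0.
rewrite ratF_ext_div => /(canRL (divfK _)).
rewrite tofrac_eq0 => /(_ iv0) /eqP; rewrite -tofracM tofrac_eq => /eqP e.
have /dvdpP[B ->] : v %| u by rewrite -(dvdp_map iota) e dvdp_mull.
by exists B; rewrite tofracM mulfK // tofrac_eq0.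
Qed.

End RatFExt.

(** * Regularity of a rational function at a point *)

Section RegularAt.
Variable K : fieldType.
Implicit Types (x y a : K) (g h : ratF K) (p r : {poly K}).

(** The fraction may be non-reduced: one denominator that does not vanish at [x] is enough, which
    makes closure under sums and products immediate. *)
Definition regular_at x h :=
  exists p r : {poly K}, r.[x] != 0 /\ h = p%:F / r%:F.

Lemma horner_neq0 p x : p.[x] != 0 -> p != 0.
Proof. by apply: contraNneq => ->; rewrite horner0. Qed.

Lemma regular_at_poly x p : regular_at x p%:F.
Proof. by exists p, 1; rewrite hornerC oner_neq0 tofrac1 divr1. Qed.

Lemma regular_at_inv x p : p.[x] != 0 -> regular_at x (p%:F)^-1.
Proof. by move=> px; exists 1, p; rewrite tofrac1 mul1r. Qed.

Lemma regular_atD x g h : regular_at x g -> regular_at x h -> regular_at x (g + h).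
Proof.
move=> [p [r [rx ->]]] [p' [r' [rx' ->]]].
exists (p * r' + p' * r), (r * r'); split; first by rewrite hornerM mulf_neq0.
exact: tofrac_divD (horner_neq0 rx) (horner_neq0 rx').
Qed.

Lemma regular_atM x g h : regular_at x g -> regular_at x h -> regular_at x (g * h).
Proof.
move=> [p [r [rx ->]]] [p' [r' [rx' ->]]].
exists (p * p'), (r * r'); split; first by rewrite hornerM mulf_neq0.
exact: tofrac_divM.
Qed.

Lemma regular_atN x h : regular_at x h -> regular_at x (- h).
Proof. by move=> [p [r [rx ->]]]; exists (- p), r; rewrite tofracN mulNr. Qed.

Lemma regular_atX x h n : regular_at x h -> regular_at x (h ^+ n).
Proof.
move=> rh; elim: n => [|n IHn]; last by rewrite exprS; apply: regular_atM.
by rewrite expr0 -tofrac1; apply: regular_at_poly.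
Qed.

Lemma regular_at_sum x (I : Type) (s : seq I) (P : pred I) (F : I -> ratF K) :
  (forall i, P i -> regular_at x (F i)) -> regular_at x (\sum_(i <- s | P i) F i).
Proof.
move=> rF; apply: (big_ind (regular_at x)) => //; last exact: regular_atD.
by rewrite -tofrac0; apply: regular_at_poly.
Qed.

Lemma not_regular_at_XsubC_inv x : ~ regular_at x (('X - x%:P)%:F)^-1.
Proof.
move=> [p [r [rx]]]; rewrite -[LHS]div1r -tofrac1.
have X0 := negbT (polyXsubC_eq0 x).
move/(tofrac_div_eq _ _ X0 (horner_neq0 rx)); rewrite mul1r => rE.
by move: rx; rewrite rE hornerM hornerXsubC subrr mulr0 eqxx.
Qed.

(** [dilate_x] over an arbitrary field, so that the same map is available on k(t)(x) and over the
    closure of k(t). *)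
Definition dilate a : ratF K -> ratF K := fracmap (fun p => p \Po (a *: 'X)).

Lemma comp_scale_inj a : a != 0 -> injective (fun p : {poly K} => p \Po (a *: 'X)).
Proof. by move=> a0; apply: can_inj (fun p => comp_poly_scaleK p a0). Qed.

Lemma horner_comp_scale a p x : (p \Po (a *: 'X)).[x] = p.[a * x].
Proof. by rewrite horner_comp hornerZ hornerX. Qed.

Lemma comp_scale_eq0 a p : a != 0 -> (p \Po (a *: 'X) == 0) = (p == 0).
Proof.
by move=> a0; rewrite -[X in _ == X](comp_poly0 (a *: 'X)) (inj_eq (comp_scale_inj a0)).
Qed.

Lemma dilate_div a p r : a != 0 -> r != 0 ->
  dilate a (p%:F / r%:F) = (p \Po (a *: 'X))%:F / (r \Po (a *: 'X))%:F.
Proof. by move=> /comp_scale_inj aI; apply: (fracmap_div (phi := comp_poly (a *: 'X)) aI). Qed.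

Lemma dilate0 a : a != 0 -> dilate a 0 = 0.
Proof.
move=> a0; rewrite -{1}(mul0r (1 : {poly K})%:F^-1) -tofrac0 dilate_div ?oner_neq0 //.
by rewrite comp_poly0 tofrac0 mul0r.
Qed.

Lemma regular_at_dilate a x h :
  a != 0 -> regular_at x (dilate a h) <-> regular_at (a * x) h.
Proof.
move=> a0; have a0' : a^-1 != 0 by rewrite invr_eq0.
split=> [[p [r [rx hE]]]|[p [r [rx hE]]]]; last first.
  exists (p \Po (a *: 'X)), (r \Po (a *: 'X)); rewrite horner_comp_scale; split=> [//|].
  by rewrite hE; apply: dilate_div => //; apply: horner_neq0 rx.
(* The given fraction with x replaced by x / a; the same substitution undoes the dilation in the
   cross-multiplied identity. *)
exists (p \Po (a^-1 *: 'X)), (r \Po (a^-1 *: 'X)); rewrite horner_comp_scale mulKf //.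
split=> [//|]; move: hE; rewrite (frac_numden h); have := denom_ratioP (repr h).
move: (\n_(repr h)) (\d_(repr h)) => u v v0.
rewrite dilate_div //.
have v0' : v \Po (a *: 'X) != 0 by rewrite comp_scale_eq0.
have r0' : r \Po (a^-1 *: 'X) != 0 by rewrite comp_scale_eq0 // (horner_neq0 rx).
move/(tofrac_div_eq _ _ v0' (horner_neq0 rx)).
move=> /(congr1 (fun t => t \Po (a^-1 *: 'X))); rewrite !rmorphM /= !comp_poly_scaleK // => e.
exact/tofrac_div_eq.
Qed.

(** The points [a ^+ n * x] are pairwise distinct, so a nonzero polynomial cannot vanish at [size p]
    of them. *)
Lemma exists_horner_geometric_neq0 a x p : p != 0 -> x != 0 -> a != 0 ->
  (forall n, (0 < n)%N -> a ^+ n != 1) -> exists n : nat, p.[a ^+ n * x] != 0.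
Proof.
move=> p0 x0 a0 a1; apply: contrapT => /forallNP rp.
pose s := [seq a ^+ n * x | n <- iota 0 (size p)].
suff us : uniq s.
  have: (size s < size p)%N.
    apply: max_poly_roots => //; apply/allP => _ /mapP[n _ ->].
    by apply/rootP; have /negP := rp n; rewrite negbK => /eqP.
  by rewrite size_map size_iota ltnn.
rewrite map_inj_uniq ?iota_uniq //.
have ltP m n : (m < n)%N -> a ^+ m * x != a ^+ n * x.
  move=> mn; rewrite (inj_eq (mulIf x0)) -(subnKC (ltnW mn)) exprD -{1}[a ^+ m]mulr1.
  by rewrite (inj_eq (mulfI (expf_neq0 _ a0))) eq_sym a1 // subn_gt0.
by move=> m n /eqP; case: (ltngtP m n) => // [/ltP/negPf->|/ltP/negPf]; rewrite // eq_sym => ->.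
Qed.

Lemma exists_regular_at_geometric a x h : x != 0 -> a != 0 ->
  (forall n, (0 < n)%N -> a ^+ n != 1) -> exists n : nat, regular_at (a ^+ n * x) h.
Proof.
move=> x0 a0 a1.
have [n vn] := exists_horner_geometric_neq0 (denom_ratioP (repr h)) x0 a0 a1.
by exists n, \n_(repr h), \d_(repr h); split; [|apply: frac_numden].
Qed.

(* Where Qh - h is regular, h is regular at a y iff it is regular at y. Far out
   on both ends of the orbit h is regular, so regularity propagates down to
   [a * x] from one end and to [x] from the other. *)
Lemma regular_at_dilate_sub a x h : x != 0 -> a != 0 ->
  (forall n, (0 < n)%N -> a ^+ n != 1) ->
  (forall z : int, z != 0 -> regular_at (a ^ z * x) (dilate a h - h)) ->
  regular_at x (dilate a h - h).
Proof.
move=> x0 a0 a1 rH.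
have up y : regular_at y (dilate a h - h) -> regular_at y h -> regular_at (a * y) h.
  move=> rd rh; apply/regular_at_dilate => //.
  by rewrite -(subrK h (dilate a h)); apply: regular_atD.
have down y : regular_at y (dilate a h - h) -> regular_at (a * y) h -> regular_at y h.
  move=> rd /regular_at_dilate - /(_ a0) rdh.
  by rewrite -(subKr (dilate a h) h); apply: regular_atD rdh (regular_atN rd).
have rpos : regular_at (a * x) h.
  have [n] := exists_regular_at_geometric h (mulf_neq0 a0 x0) a0 a1.
  elim: n => [|n IHn]; first by rewrite mul1r.
  rewrite exprS -mulrA => rn; apply: IHn; apply: down rn.
  by rewrite mulrA -exprSr; apply: (rH n.+1).
have rneg : regular_at x h.
  have a1' n : (0 < n)%N -> a^-1 ^+ n != 1.
    by move=> n0; rewrite exprVn invr_eq1 a1.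
  have [n] := exists_regular_at_geometric h x0 (invr_neq0 a0) a1'.
  elim: n => [|n IHn]; first by rewrite mul1r.
  move=> rn; apply: IHn; rewrite -[a^-1 ^+ n](mulVKf a0) -exprS -mulrA.
  (* [Negz n] is -(n+1), a nonzero exponent, so [rH] applies at each point visited. *)
  by apply: up rn; rewrite exprVn; apply: (rH (Negz n)).
by apply: regular_atD (regular_atN rneg); apply/regular_at_dilate.
Qed.

End RegularAt.

(** * Partial fractions and their poles *)

Lemma mulf_divX_sub (F : fieldType) (a b x : F) (i j : nat) : x != 0 -> (j <= i)%N ->
  a / x ^+ j * (b * x ^+ i) = a * (b * x ^+ (i - j)).
Proof.
move=> x0 ji; rewrite -{1}(subnK ji) exprD [b * _]mulrA [_ * x ^+ j]mulrC -mulrA.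
by rewrite mulKf ?expf_neq0.
Qed.

(** Applied to X - beta: a pole of order r + 1 becomes simple, and its residue is the top
    coefficient. *)
Lemma polar_mulX (F : fieldType) (a : nat -> F) (x : F) (r : nat) : x != 0 ->
  (\sum_(1 <= j < r.+2) a j / x ^+ j) * x ^+ r =
  \sum_(1 <= j < r.+1) a j * x ^+ (r - j) + a r.+1 / x.
Proof.
move=> x0; rewrite big_nat_recr //= mulrDl mulr_suml; congr (_ + _).
  apply: eq_big_nat => j /andP[_]; rewrite ltnS => jr.
  by rewrite -[x ^+ r]mul1r mulf_divX_sub // mul1r.
by rewrite exprS invfM mulrA -mulrA mulVf ?mulr1 ?expf_neq0.
Qed.

Section PolarParts.
Variables (K : fieldType) (c : K) (m : nat) (n : 'I_m -> nat).
Variables (alpha : 'I_m -> nat -> K) (beta : 'I_m -> K).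
Hypothesis n_gt0 : forall i, (0 < n i)%N.

Let polar i := \sum_(1 <= j < (n i).+1)
  (alpha i j)%:P%:F / ('X - (beta i)%:P)%:F ^+ j : ratF K.
Let h : ratF K := c%:P%:F + \sum_(i < m) polar i.

Let regular_at_polar i x : x != beta i -> regular_at x (polar i).
Proof.
move=> xb; apply: regular_at_sum => j _; apply: regular_atM.
  exact: regular_at_poly.
rewrite -exprVn; apply/regular_atX/regular_at_inv.
by rewrite hornerXsubC subr_eq0.
Qed.

Lemma regular_at_polar_sum x : (forall i, x != beta i) -> regular_at x h.
Proof.
move=> xb; apply: regular_atD; first exact: regular_at_poly.
by apply: regular_at_sum => i _; apply: regular_at_polar.
Qed.

(** The other polar parts are regular at [beta i], so this one would be too. Multiplied by (X -
    beta_i)^(n_i - 1), stripped of its polynomial part and divided by the top coefficient, it would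
    make 1 / (X - beta_i) regular. *)
Lemma not_regular_at_polar_sum i : injective beta -> alpha i (n i) != 0 ->
  ~ regular_at (beta i) h.
Proof.
move=> betaI a0 rh.
have rp : regular_at (beta i) (polar i).
  have -> : polar i = h - (c%:P%:F + \sum_(j < m | j != i) polar j).
    by rewrite /h (bigD1 i) //= addrCA addrK.
  apply: regular_atD rh (regular_atN (regular_atD (regular_at_poly _ _) _)).
  apply: regular_at_sum => j ji; apply: regular_at_polar.
  by apply: contraNneq ji => /betaI ->.
set X := ('X - (beta i)%:P)%:F : ratF K.
have X0 : X != 0 by rewrite tofrac_eq0 polyXsubC_eq0.
case nE: (n i) (n_gt0 i) => [//|r] _.
apply: (@not_regular_at_XsubC_inv _ (beta i)); rewrite -/X.
have rX j : regular_at (beta i) (X ^+ j) by apply/regular_atX/regular_at_poly.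
have := regular_atM rp (rX r); rewrite /polar nE -/X polar_mulX // => rs.
have rt : regular_at (beta i) ((alpha i r.+1)%:P%:F / X).
  rewrite -[Y in regular_at _ Y](addKr (\sum_(1 <= j < r.+1) (alpha i j)%:P%:F * X ^+ (r - j))).
  rewrite addrC; apply: regular_atD rs (regular_atN _); apply: regular_at_sum => j _.
  exact: regular_atM (regular_at_poly _ _) (rX _).
have := regular_atM (regular_at_poly (beta i) ((alpha i r.+1)^-1)%:P) rt.
by rewrite mulrA -tofracM -polyCM mulVf -?nE // tofrac1 mul1r.
Qed.

Lemma polar_sum_clear (P : {poly K}) :
  (forall i, ('X - (beta i)%:P) ^+ n i %| P) -> exists A : {poly K}, h * P%:F = A%:F.
Proof.
move=> dP.
have sumF (I : Type) (s : seq I) (G : I -> ratF K) :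
    (forall i, exists A : {poly K}, G i = A%:F) ->
    exists A : {poly K}, \sum_(i <- s) G i = A%:F.
  move=> GP; elim: s => [|i s [A IHs]]; first by exists 0; rewrite big_nil tofrac0.
  by have [B BE] := GP i; exists (B + A); rewrite big_cons IHs BE tofracD.
have [i|A AE] := sumF _ (index_enum 'I_m) (fun i => polar i * P%:F).
  have [B ->] := dvdpP _ _ (dP i).
  (* [sumF] asks for a polynomial at every index, without range information; the test [j <= n i]
     supplies the bound, and the default 0 never occurs in this sum. *)
  have [|A AE] := sumF _ (index_iota 1 (n i).+1) (fun j =>
    if (j <= n i)%N then (alpha i j)%:P%:F / ('X - (beta i)%:P)%:F ^+ j *
      (B * ('X - (beta i)%:P) ^+ n i)%:F else 0).
    move=> j; case: ifP => [jn|_]; last by exists 0; rewrite tofrac0.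
    exists ((alpha i j)%:P * (B * ('X - (beta i)%:P) ^+ (n i - j))).
    have X0 : ('X - (beta i)%:P)%:F != 0 :> ratF K by rewrite tofrac_eq0 polyXsubC_eq0.
    have BX e : (B * ('X - (beta i)%:P) ^+ e)%:F = B%:F * ('X - (beta i)%:P)%:F ^+ e.
      by rewrite tofracM tofracXn.
    by rewrite BX mulf_divX_sub // -BX [RHS]tofracM.
  exists A; rewrite -AE mulr_suml.
  by apply: eq_big_nat => j /andP[_]; rewrite ltnS => ->.
by exists (c%:P * P + A); rewrite tofracD -AE tofracM mulrDl mulr_suml.
Qed.

End PolarParts.

(** * Eigenvectors of the shift *)

Section ShiftEigen.
Variables (k : fieldType) (char_k : [pchar k] =i pred0).

Lemma iter_shift_tofrac l (p : {poly k}) :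
  iter l (@shift k) p%:F = (p \Po ('X + l%:R%:P))%:F.
Proof.
elim: l => [|l IHl] /=; first by rewrite addr0 comp_polyXr.
rewrite IHl shift_tofrac -comp_polyA comp_polyD comp_polyX comp_polyC.
by rewrite -addrA -polyC1 -polyCD nat1r.
Qed.

Lemma size_XaddC (a : k) : size ('X + a%:P) = 2%N.
Proof. by rewrite -[a]opprK polyCN size_XsubC. Qed.

(** For nonzero u, leading coefficients force c = 1; then u - u(0) vanishes at all multiples of l,
    which are infinitely many in characteristic zero. *)
Lemma comp_shift_eigen l (c : k) (u : {poly k}) : (0 < l)%N ->
  u \Po ('X + l%:R%:P) = c *: u -> exists b, u = b%:P.
Proof.
move=> l0 uE; have [->|u0] := eqVneq u 0; first by exists 0.
have c1 : c = 1.
  have := congr1 lead_coef uE; rewrite lead_coefZ lead_coef_comp ?size_XaddC //.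
  rewrite -[l%:R]opprK polyCN lead_coefXsubC expr1n mulr1 => /esym/eqP.
  by rewrite -{2}[lead_coef u]mul1r (inj_eq (mulIf _)) ?lead_coef_eq0 // => /eqP.
rewrite c1 scale1r in uE.
exists u.[0]; apply/eqP; rewrite -subr_eq0; apply: contraT => w0.
pose s := [seq (i * l)%:R : k | i <- iota 0 (size (u - u.[0]%:P))].
have : (size s < size (u - u.[0]%:P)%R)%N.
  apply: max_poly_roots => //.
    apply/allP => _ /mapP[i _ ->]; rewrite rootE !hornerE subr_eq0.
    elim: i => [|i /eqP <-]; first by rewrite mul0n.
    by rewrite -{2}uE horner_comp !hornerE -natrD mulSn addnC.
  rewrite map_inj_uniq ?iota_uniq // => i j.
  wlog ij : i j / (i <= j)%N.
    by move=> H e; case: (leqP i j) => [/H|/ltnW/H]; [apply|move=> /(_ (esym e))].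
  move/esym/eqP; rewrite -subr_eq0 -natrB ?leq_pmul2r // -mulnBl.
  by rewrite (pcharf0P k).1 // muln_eq0 [l == _]gtn_eqF // orbF subn_eq0 => ji;
     apply/eqP; rewrite eqn_leq ij.
by rewrite size_map size_iota ltnn.
Qed.

(** Write a = u / v in lowest terms. Then v(X + l) divides u(X + l) v and is coprime to u(X + l), so
    it is proportional to v; [comp_shift_eigen] makes first v, then u, constant. *)
Lemma iter_shift_eigen l (c : k) (a : ratF k) : (0 < l)%N ->
  iter l (@shift k) a = c%:P%:F * a -> exists b : k, a = b%:P%:F.
Proof.
move=> l0; rewrite (frac_numden a); have := denom_ratioP (repr a).
move: (\n_(repr a)) (\d_(repr a)) => u v v0.
have g0 : gcdp u v != 0 by rewrite gcdp_eq0 negb_and v0 orbT.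
have cuv : coprimep (u %/ gcdp u v) (v %/ gcdp u v).
  by rewrite coprimep_div_gcd // v0 orbT.
have -> : u%:F / v%:F = (u %/ gcdp u v)%:F / (v %/ gcdp u v)%:F :> ratF k.
  have v1 : v %/ gcdp u v != 0 by rewrite dvdp_div_eq0 ?dvdp_gcdr.
  apply/(tofrac_div_eq _ _ v0 v1).
  have cross (g u' v' : {poly k}) : u = u' * g -> v = v' * g -> u * v' = u' * v.
    by move=> -> ->; rewrite mulrAC mulrA.
  by apply: (cross (gcdp u v)); rewrite divpK ?dvdp_gcdl ?dvdp_gcdr.
have : v %/ gcdp u v != 0 by rewrite dvdp_div_eq0 ?dvdp_gcdr.
move: (u %/ _) (v %/ _) cuv => {g0 v0}u1 v1 cuv v0.
have sX := size_XaddC l%:R.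
have v2 : v1 \Po ('X + l%:R%:P) != 0 by rewrite comp_poly2_eq0.
have -> : iter l (@shift k) (u1%:F / v1%:F) =
    (u1 \Po ('X + l%:R%:P))%:F / (v1 \Po ('X + l%:R%:P))%:F.
  rewrite -!iter_shift_tofrac; elim: (l) => //= j ->.
  exact: fmorph_div.
rewrite mulrA -tofracM => /(tofrac_div_eq _ _ v2 v0) e.
have /eqpP[[b1 b2] /= /andP[b10 b20] bE] : v1 \Po ('X + l%:R%:P) %= v1.
  have cvu : coprimep (v1 \Po ('X + l%:R%:P)) (u1 \Po ('X + l%:R%:P)).
    by rewrite coprimep_sym coprimep_comp_poly.
  by rewrite -dvdp_size_eqp ?size_comp_poly2 // -(Gauss_dvdpr _ cvu) e dvdp_mulIr.
have [|d vd] := @comp_shift_eigen l (b2 / b1) v1 l0.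
  by rewrite mulrC -scalerA -bE scalerA mulVf // scale1r.
move: e v0; rewrite vd comp_polyC polyC_eq0 => e d0.
have dP0 : d%:P != 0 by rewrite polyC_eq0.
have [|d' ->] := @comp_shift_eigen l c u1 l0.
  by rewrite -mul_polyC; apply: (mulIf dP0).
exists (d' / d); apply: (canLR (mulfK _)); first by rewrite tofrac_eq0.
by rewrite -tofracM -polyCM divfK.
Qed.

End ShiftEigen.

(** * Minimal polynomials, constant roots, cycles in finite sets *)

Lemma exists_minpoly (E K : fieldType) (iota : {rmorphism E -> K}) (z : K) :
  algebraicOver iota z -> exists p : {poly E}, [/\ p \is monic,
    root (map_poly iota p) z & forall r, root (map_poly iota r) z -> p %| r].
Proof.
pose P d := `[< exists p : {poly E}, [/\ p != 0, root (map_poly iota p) z & size p = d] >].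
move=> [p0 p00 rp0].
have exP : exists d, P d by exists (size p0); apply/asboolP; exists p0.
case: (ex_minnP exP) => d /asboolP[p [p_neq0 rp pd]] dmin.
have lp0 : lead_coef p != 0 by rewrite lead_coef_eq0.
exists ((lead_coef p)^-1 *: p); split.
- by rewrite monicE lead_coefZ mulVf.
- by rewrite map_polyZ /= rootZ // fmorph_eq0 invr_eq0.
move=> r rr; rewrite dvdpZl ?invr_eq0 //; apply: contraT => rp_neq0.
(* The remainder also vanishes at [z] and is smaller than [p], so minimality would be violated if it
   were nonzero. *)
have rm : root (map_poly iota (r %% p)) z.
  move: rr; rewrite {1}(divp_eq r p) rmorphD rmorphM /= rootE !hornerE.
  by rewrite (rootP rp) mulr0 add0r.
have : (d <= size (r %% p)%R)%N by apply: dmin; apply/asboolP; exists (r %% p).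
by rewrite leqNgt -pd ltn_modp p_neq0.
Qed.

(** [p] comes from a polynomial over k, which splits there; the images of its linear factors account
    for all roots in K. *)
Lemma root_constant_coefs (k : closedFieldType) (E K : fieldType)
    (cst : {rmorphism k -> E}) (iota : {rmorphism E -> K}) (p : {poly E}) (z : K) :
  p != 0 -> (forall j, exists b : k, p`_j = cst b) ->
  root (map_poly iota p) z -> exists b : k, z = iota (cst b).
Proof.
move=> p0 /boolp.choice[b pE].
have {}pE : p = map_poly cst (\poly_(j < size p) b j).
  apply/polyP => j; rewrite coef_map coef_poly; case: ltnP => [_|]; first exact: pE.
  by move=> /(nth_default 0) ->; apply/esym/(rmorph0 cst).
have [s sE] := closed_field_poly_normal (\poly_(j < size p) b j).
move: p0; rewrite pE sE; set a := lead_coef _.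
rewrite map_polyZ /= scaler_eq0 negb_or fmorph_eq0 => /andP[a0 _].
rewrite map_polyZ /= rootZ ?fmorph_eq0 // !rmorph_prod rootE horner_prod.
rewrite prodf_seq_eq0 => /hasP[r _ /=].
rewrite !map_polyXsubC hornerXsubC subr_eq0 => /eqP ->.
by exists r.
Qed.

(** A chain of successors in a finite set revisits some element, and transitivity collapses the
    closed walk into a loop. *)
Lemma exists_reflexive (T : finType) (P : T -> Prop) (R : T -> T -> Prop) :
  (forall x y z, R x y -> R y z -> R x z) ->
  (forall x, P x -> exists y, P y /\ R x y) ->
  forall x, P x -> exists y, P y /\ R y y.
Proof.
move=> Rt PR x0 Px0.
(* Outside [P] any value serves; [x] itself makes the choice function total. *)
have /fin_all_exists[f fP] (x : T) : exists y, P x -> P y /\ R x y.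
  by have [/PR[y Py]|nPx] := pselect (P x); [exists y|exists x].
have Pi j : P (iter j f x0) by elim: j => //= j /fP[].
have Ri i j : (i < j)%N -> R (iter i f x0) (iter j f x0).
  elim: j => // j IHj; rewrite ltnS leq_eqVlt => /predU1P[->|/IHj ij] /=.
    by have [_] := fP _ (Pi j).
  by apply: Rt ij _; have [_] := fP _ (Pi j).
have /injectivePn[i [j ij e]] : ~~ injectiveb (fun i : 'I_(#|T|.+1) => iter i f x0).
  by apply/injectiveP => /leq_card; rewrite card_ord ltnn.
suff H (i' j' : nat) : (i' < j')%N -> iter i' f x0 = iter j' f x0 ->
    exists y, P y /\ R y y.
  case: (ltngtP i j) => [/H|/H|/val_inj ijE]; [exact|by apply|].
  by rewrite ijE eqxx in ij.
by move=> lt_ij E; exists (iter i' f x0); split=> //; rewrite {2}E; apply: Ri.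
Qed.

(** * Dilations under extension of the field *)

Lemma dilate_commute (E F : fieldType) (phi : {rmorphism ratF E -> ratF F})
    (psi : {rmorphism {poly E} -> {poly F}}) (a : E) (b : F) (h : ratF E) :
  a != 0 -> b != 0 -> injective psi ->
  (forall p : {poly E}, phi p%:F = (psi p)%:F) ->
  (forall p : {poly E}, psi (p \Po (a *: 'X)) = psi p \Po (b *: 'X)) ->
  phi (dilate a h) = dilate b (phi h).
Proof.
move=> a0 b0 psiI phiE psiE; rewrite (frac_numden h); have := denom_ratioP (repr h).
move: (\n_(repr h)) (\d_(repr h)) => u v v0.
rewrite dilate_div // !fmorph_div !phiE !psiE dilate_div //.
by rewrite -(rmorph0 psi) (inj_eq psiI).
Qed.

Lemma ratF_ext_dilate (E K : fieldType) (iota : {rmorphism E -> K}) (a : E) (h : ratF E) :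
  a != 0 -> ratF_ext iota (dilate a h) = dilate (iota a) (ratF_ext iota h).
Proof.
move=> a0; apply: (dilate_commute (phi := ratF_ext iota) (psi := map_poly iota)) => //.
- by rewrite fmorph_eq0.
- exact: map_poly_rmorph_inj.
- exact: ratF_ext_tofrac.
by move=> p; rewrite /= map_comp_poly map_polyZ map_polyX.
Qed.

Lemma ratF_ext_dilate_sub (E K : fieldType) (iota : {rmorphism E -> K}) (a : E) (b : K)
    (h : ratF E) : a != 0 -> iota a = b ->
  ratF_ext iota (dilate a h - h) = dilate b (ratF_ext iota h) - ratF_ext iota h.
Proof. by move=> a0 <-; rewrite rmorphB /= ratF_ext_dilate. Qed.

Lemma ratF_ext_lin_comb (E K : fieldType) (iota : {rmorphism E -> K}) s
    (a : nat -> E) (h : nat -> ratF E) :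
  ratF_ext iota (\sum_(l < s) (a l)%:P%:F * h l) =
  \sum_(l < s) (iota (a l))%:P%:F * ratF_ext iota (h l).
Proof.
rewrite rmorph_sum; apply: eq_bigr => l _.
by rewrite rmorphM /= ratF_ext_tofrac map_polyC.
Qed.

Lemma coef_comp_scale (R : comNzRingType) (p : {poly R}) (a : R) j :
  (p \Po (a *: 'X))`_j = p`_j * a ^+ j.
Proof.
rewrite comp_polyE coef_sum; under eq_bigr do rewrite exprZn scalerA coefZ coefXn.
case: (ltnP j (size p)) => jp.
  rewrite (bigD1 (Ordinal jp)) //= eqxx mulr1 big1 ?addr0 // => i ij.
  by rewrite eq_sym (negPf (ij : (i : nat) != j)) mulr0.
rewrite (nth_default _ jp) mul0r big1 // => i _.
by rewrite gtn_eqF ?mulr0 // (leq_trans (ltn_ord i)).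
Qed.

(** * Operators over E with respect to an endomorphism sigma *)

Section SkewOperators.
Variables (E : fieldType) (sigma : {rmorphism E -> E}).
Local Notation sigma_x := (ratF_ext sigma).

(* For E = k(t) and sigma = [@shift k] this is convertible to [op_act]. *)
Definition skew_act (L : {poly E}) (h : ratF E) : ratF E :=
  \sum_(l < size L) (L`_l)%:P%:F * iter l sigma_x h.

Lemma skew_act_widen (L : {poly E}) (h : ratF E) s : (size L <= s)%N ->
  skew_act L h = \sum_(l < s) (L`_l)%:P%:F * iter l sigma_x h.
Proof.
move=> Ls; rewrite /skew_act (big_ord_widen s (fun l => (L`_l)%:P%:F * iter l sigma_x h)) //.
rewrite big_mkcond; apply: eq_bigr => l _; case: ltnP => // /(nth_default 0) ->.
by rewrite polyC0 tofrac0 mul0r.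
Qed.

(** If the coefficient of S^0 vanishes, then L = S L', and the inverse of S turns the equation for L
    into one for L': it fixes [a], so it commutes with the dilation. The size drops each time. *)
Lemma skew_act_coef0_neq0 (tau : {rmorphism E -> E}) (a : E) (L : {poly E}) (f g : ratF E) :
  cancel sigma tau -> a != 0 -> tau a = a ->
  L != 0 -> skew_act L f = dilate a g - g ->
  exists (L' : {poly E}) (g' : ratF E), L'`_0 != 0 /\ skew_act L' f = dilate a g' - g'.
Proof.
move=> sigmaK a0 ta.
have sigma_xK : cancel sigma_x (ratF_ext tau).
  apply: (frac_rmorph_eq (A := ratF_ext tau \o sigma_x) (B := idfun)) => p /=.
  rewrite !ratF_ext_tofrac; congr (_%:F); apply/polyP => j.
  by rewrite !coef_map; apply: sigmaK.
move sE: (size L) => s.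
elim: s L g sE => [|s IHs] L g sE L0 Lf; first by rewrite -size_poly_eq0 sE in L0.
have [L00|L00] := eqVneq L`_0 0; last by exists L, g.
(* Coefficients move down one place, and [tau] hits them because it is applied to the whole
   equation. *)
pose L' : {poly E} := \poly_(l < s) tau L`_l.+1.
have L's : size L' = s.
  rewrite {}/L'; case: s {IHs} sE => [|s] sE; first by rewrite poly_def big_ord0 size_poly0.
  by rewrite size_poly_eq // fmorph_eq0; move: L0; rewrite -lead_coef_eq0 lead_coefE sE.
apply: (IHs L' (ratF_ext tau g)) => //.
  rewrite -size_poly_eq0 L's; apply: contraTneq L0 => s0.
  have -> : L = (L`_0)%:P by apply: size1_polyC; rewrite sE s0.
  by rewrite L00 negbK.
have -> := @skew_act_widen L' f s; last by rewrite L's.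
have t0 : (L`_0)%:P%:F * iter 0 sigma_x f = 0 by rewrite L00 polyC0 tofrac0 mul0r.
rewrite -(ratF_ext_dilate_sub g a0 ta) -Lf /skew_act sE big_ord_recl [X in X + _]t0 add0r.
rewrite rmorph_sum; apply: eq_bigr => l _.
rewrite rmorphM /= sigma_xK ratF_ext_tofrac map_polyC /=.
by rewrite coef_poly ltn_ord.
Qed.

Lemma iter_ratF_ext_div l (A P : {poly E}) : iter l sigma_x (A%:F / P%:F) =
  (iter l (map_poly sigma) A)%:F / (iter l (map_poly sigma) P)%:F.
Proof.
by elim: l => //= l ->; rewrite ratF_ext_div.
Qed.

Lemma coef_iter_map_poly l (A : {poly E}) j :
  (iter l (map_poly sigma) A)`_j = iter l sigma A`_j.
Proof. by elim: l => //= l <-; rewrite coef_map. Qed.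

Lemma size_iter_map_poly l (A : {poly E}) :
  size (iter l (map_poly sigma) A) = size A.
Proof. by elim: l => //= l <-; rewrite size_map_poly. Qed.

(** All iterates of A / P share the fixed denominator P, so only numerators have to be combined, and
    [size A] + 1 vectors of [size A] coefficients are dependent over E. *)
Lemma exists_annihilator (A P : {poly E}) : map_poly sigma P = P ->
  exists2 L : {poly E}, L != 0 & skew_act L (A%:F / P%:F) = 0.
Proof.
move=> PS; pose N := size A.
pose M := \matrix_(l < N.+1, j < N) (iter l (map_poly sigma) A)`_j.
have /rowV0Pn[v /sub_kermxP vM v0] : kermx M != 0.
  rewrite kermx_eq0 /row_free; apply: contraTneq (rank_leq_col M) => ->.
  by rewrite -ltnNge.
exists (rVpoly v).
  by apply: contraNneq v0 => e; rewrite -[v]rVpolyK e linear0.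
have PSi l : iter l (map_poly sigma) P = P by elim: l => //= l ->.
rewrite (skew_act_widen _ (size_poly _ _)).
under eq_bigr do rewrite iter_ratF_ext_div PSi mulrA -tofracM mul_polyC coef_rVpoly_ord.
rewrite -mulr_suml -rmorph_sum /=.
rewrite [X in X%:F](_ : _ = 0) ?tofrac0 ?mul0r //; apply/polyP => j.
(* Coefficients from [size A] on vanish in every iterate; the others are entries of [v *m M]. *)
rewrite coef0 coef_sum; case: (ltnP j N) => jN; last first.
  rewrite big1 // => l _; rewrite coefZ nth_default ?mulr0 //.
  by rewrite size_iter_map_poly.
transitivity ((v *m M) 0 (Ordinal jN)); last by rewrite vM mxE.
by rewrite mxE; apply: eq_bigr => l _; rewrite coefZ mxE.
Qed.

End SkewOperators.

(** * The criterion *)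

Section Telescoping.
(** E plays the role of k(t), [cst] of the inclusion of k, K of the algebraic closure, [sigma] of
    the shift and [tau] of its inverse. *)
Variables (k : closedFieldType) (E : fieldType) (cst : {rmorphism k -> E}).
Variables (sigma tau : {rmorphism E -> E}) (sigmaK : cancel sigma tau).
Hypothesis sigma_cst : forall b, sigma (cst b) = cst b.
Hypothesis sigma_eigen : forall l b u, (0 < l)%N ->
  iter l sigma u = cst b * u -> exists d, u = cst d.
Variables (q : k) (q_neq0 : q != 0) (q_nroot : forall i : int, i != 0 -> q ^ i != 1).
Variables (K : closedFieldType) (iota : {rmorphism E -> K}).
Local Notation sigma_x := (ratF_ext sigma).
Local Notation sigmap l := (iter l (map_poly sigma)).

Let iq (z : int) : K := iota (cst (q ^ z)).

Let iqE z : iq z = iq 1 ^ z.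
Proof. by rewrite /iq expr1z !fmorphXz. Qed.

Let iq0 : iq 0 = 1.
Proof. by rewrite iqE expr0z. Qed.

Let iq_neq0 z : iq z != 0.
Proof. by rewrite !fmorph_eq0 expfz_neq0. Qed.

Let iq_neq1 z : z != 0 -> iq z != 1.
Proof.
by move=> z0; rewrite -(rmorph1 iota) -(rmorph1 cst) !(inj_eq (fmorph_inj _)) q_nroot.
Qed.

(* [p] divides the image of [p'] under sigma^l and x |-> q^z x, so by equality of
   sizes they agree up to a constant factor. *)
Lemma shift_coefs_constant_ratio (p p' : {poly E}) (l : nat) (z : int) (y : K) :
  p \is monic -> p' \is monic -> (size p' <= size p)%N ->
  (forall r, root (map_poly iota r) y -> p %| r) ->
  root (map_poly iota (sigmap l p')) (iq z * y) ->
  size p' = size p /\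
  forall j, exists c : k, iter l sigma p'`_j = cst c * p`_j.
Proof.
move=> pm pm' le_sp pmin rz; pose a : E := cst (q ^ z).
have a0 : a != 0 by rewrite fmorph_eq0 expfz_neq0.
pose W := sigmap l p' \Po (a *: 'X).
have aX2 : size (a *: 'X) = 2%N by rewrite size_scale // size_polyX.
have sW' : size W = size p' by rewrite size_comp_poly2 // size_iter_map_poly.
have W0 : W != 0 by rewrite -size_poly_eq0 sW' size_poly_eq0 monic_neq0.
have pW : p %| W.
  apply: pmin; rewrite /W map_comp_poly map_polyZ map_polyX rootE.
  by rewrite horner_comp hornerZ hornerX; apply: rz.
have sp : size p' = size p.
  by apply/eqP; rewrite eqn_leq le_sp -sW' dvdp_leq.
split=> // j; have sW : size W = size p by rewrite sW'.
have Wj i : W`_i = iter l sigma p'`_i * a ^+ i.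
  by rewrite coef_comp_scale coef_iter_map_poly.
have l1 : iter l sigma 1 = 1 :> E by elim: (l) => //= i ->; rewrite rmorph1.
have /eqpP[[c1 c2] /= /andP[c10 c20] cE] : p %= W by rewrite -dvdp_size_eqp // sW.
have lW : lead_coef W = a ^+ (size p).-1.
  rewrite lead_coefE sW Wj -sp -lead_coefE (monicP pm') l1 mul1r //.
have WE : W = a ^+ (size p).-1 *: p.
  have c1E : c1 = c2 * a ^+ (size p).-1.
    by have := congr1 lead_coef cE; rewrite !lead_coefZ (monicP pm) lW mulr1.
  by apply: (scalerI c20); rewrite -cE c1E scalerA.
(* With d the degree of p, coefficient j of W = a^d p reads sigma^l(p'_j) a^j = a^d p_j, so the
   ratio is q^(z (d - j)). *)
exists ((q ^ z) ^+ (size p).-1 / (q ^ z) ^+ j).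
apply: (mulIf (expf_neq0 j a0)); rewrite -Wj WE coefZ mulrAC; congr (_ * _).
by rewrite /a -!rmorphXn -rmorphM divfK // expf_neq0 // expfz_neq0.
Qed.

Variables (f : ratF E) (c : E) (m : nat) (n : 'I_m -> nat).
Variables (alpha : 'I_m -> nat -> K) (beta : 'I_m -> K).
Hypotheses (K_alg : forall z : K, algebraicOver iota z).
Hypotheses (n_gt0 : forall i, (0 < n i)%N).
Hypotheses (f_def : ratF_ext iota f =
       (iota c)%:P%:F +
       \sum_(i < m) \sum_(1 <= j < (n i).+1)
          (alpha i j)%:P%:F / ('X - (beta i)%:P)%:F ^+ j).
Hypotheses (alpha_neq0 : forall i, alpha i (n i) != 0).
Hypotheses (beta_orbits : forall (i i' : 'I_m) (z : int),
       i != i' -> beta i <> iota (cst (q ^ z)) * beta i').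

(** Over K the product is divisible by each (X - beta_i)^(n_i), so it clears every pole of f;
    [ratF_ext_poly] brings the resulting polynomial back to E. *)
Lemma common_denominator (p : 'I_m -> {poly E}) :
  (forall i, p i != 0) -> (forall i, root (map_poly iota (p i)) (beta i)) ->
  exists A : {poly E}, f = A%:F / (\prod_i p i ^+ n i)%:F.
Proof.
move=> p0 rp; set P := \prod_i _.
have P0 : P != 0 by apply/prodf_neq0 => i _; rewrite expf_neq0.
have [|A AE] := polar_sum_clear (iota c) (n := n) alpha (beta := beta) (P := map_poly iota P).
  move=> i; rewrite rmorph_prod (bigD1 i) //= dvdp_mulr // rmorphXn /=.
  by rewrite dvdp_exp2r // dvdp_XsubCl.
rewrite -f_def -ratF_ext_tofrac -rmorphM in AE.
have [B BE] := ratF_ext_poly AE.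
by exists B; rewrite -BE mulfK // tofrac_eq0.
Qed.

Let beta_inj : injective beta.
Proof.
move=> i j e; apply/eqP; apply: contraT => ij.
by case: (@beta_orbits i j 0 ij); rewrite -/(iq 0) iq0 mul1r.
Qed.

Lemma pole_shift (p : 'I_m -> {poly E}) (L : {poly E}) (g : ratF E) i :
  (forall i, p i != 0) -> (forall i, root (map_poly iota (p i)) (beta i)) ->
  L`_0 != 0 -> skew_act sigma L f = dilate (cst q) g - g -> beta i != 0 ->
  exists (i' : 'I_m) (l : nat) (z : int),
    (0 < l)%N /\ root (map_poly iota (sigmap l (p i'))) (iq z * beta i).
Proof.
move=> p0 rp L0 Lf b0; apply: contrapT => nr.
have {nr} nroot i' l z : (0 < l)%N -> ~~ root (map_poly iota (sigmap l (p i'))) (iq z * beta i).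
  by move=> l0; apply/negP => r; apply: nr; exists i', l, z.
have [A fE] := common_denominator p0 rp; set P := \prod_i _ in fE.
have fl l z : (0 < l)%N -> regular_at (iq z * beta i) (ratF_ext iota (iter l sigma_x f)).
  move=> l0; rewrite [f in iter _ _ f]fE.
  rewrite iter_ratF_ext_div.
  rewrite ratF_ext_div.
  apply: regular_atM; first exact: regular_at_poly.
  apply: regular_at_inv.
  have -> : sigmap l P = \prod_i (sigmap l (p i)) ^+ n i.
    rewrite /P; elim: (l) => //= l' ->; rewrite rmorph_prod; apply: eq_bigr => j _.
    by rewrite rmorphXn.
  rewrite rmorph_prod horner_prod; apply/prodf_neq0 => j _.
  by rewrite rmorphXn /= horner_exp expf_neq0 // -rootE nroot.
(* Distinct orbits exclude the other poles; [beta i] itself is excluded because it is nonzero and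
   q^z differs from 1. *)
have f0 z : z != 0 -> regular_at (iq z * beta i) (ratF_ext iota f).
  move=> z0; rewrite f_def; apply: regular_at_polar_sum => j.
  have [->|ji] := eqVneq j i.
    by rewrite -{2}[beta i]mul1r (inj_eq (mulIf b0)) iq_neq1.
  by rewrite eq_sym; apply/eqP; apply: beta_orbits.
have sL : (0 < size L)%N.
  by rewrite lt0n size_poly_eq0; apply: contraNneq L0 => ->; rewrite coef0.
pose G := ratF_ext iota g; pose term l := (iota L`_l)%:P%:F * ratF_ext iota (iter l sigma_x f).
pose tl := \sum_(l < (size L).-1) term l.+1.
have HE : dilate (iq 1) G - G = term 0%N + tl.
  transitivity (ratF_ext iota (skew_act sigma L f)).
    by rewrite Lf; apply/esym/ratF_ext_dilate_sub; rewrite ?fmorph_eq0 // /iq expr1z.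
  transitivity (\sum_(l < size L) term l).
    exact: (ratF_ext_lin_comb iota (size L) (fun l => L`_l) (fun l => iter l sigma_x f)).
  rewrite /tl; case: (size L) sL => // s _.
  exact: big_ord_recl.
have rtl z : regular_at (iq z * beta i) tl.
  apply: regular_at_sum => l _; apply: regular_atM; first exact: regular_at_poly.
  exact: fl.
(* Only [beta i] could be a pole on its orbit, and a single pole is impossible for Q(g) - g. *)
have : regular_at (beta i) (dilate (iq 1) G - G).
  apply: regular_at_dilate_sub => //.
    by case=> // j _; rewrite -[_ ^+ _]/(_ ^ (j.+1 : int)) -iqE iq_neq1.
  move=> z z0; rewrite -iqE HE; apply: regular_atD; last exact: rtl.
  by apply: regular_atM; [exact: regular_at_poly|exact: f0].
rewrite HE => rH.
have {}rH : regular_at (beta i) (term 0%N).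
  rewrite -[X in regular_at _ X](addrK tl); apply: regular_atD rH (regular_atN _).
  by have := rtl 0; rewrite iq0 mul1r.
have iL0 : iota L`_0 != 0 by rewrite fmorph_eq0.
have := regular_atM (regular_at_poly (beta i) ((iota L`_0)^-1)%:P) rH.
rewrite mulrA -tofracM -polyCM mulVf // tofrac1 mul1r f_def.
exact: not_regular_at_polar_sum.
Qed.

Lemma constant_poles (L : {poly E}) (g : ratF E) : L != 0 ->
  skew_act sigma L f = dilate (cst q) g - g -> forall i, exists b : k, beta i = iota (cst b).
Proof.
move=> L0 Lf i0.
have cq0 : cst q != 0 by rewrite fmorph_eq0.
have tq : tau (cst q) = cst q by rewrite -[in LHS]sigma_cst sigmaK.
(* The new operator has a nonzero coefficient of S^0, as [pole_shift] requires; f is unchanged. *)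
have {L g L0 Lf} [L [g [L0 Lf]]] := skew_act_coef0_neq0 sigmaK cq0 tq L0 Lf.
have /fin_all_exists[p pP] (i : 'I_m) := exists_minpoly (K_alg (beta i)).
have pm i : p i \is monic by case: (pP i).
have p0 i : p i != 0 by rewrite monic_neq0.
have rp i : root (map_poly iota (p i)) (beta i) by case: (pP i).
have pmin i r : root (map_poly iota r) (beta i) -> p i %| r by case: (pP i) => _ _; apply.
pose bad i := ~ exists b : k, beta i = iota (cst b).
have bad_neq0 i : bad i -> beta i != 0.
  by apply: contra_notN => /eqP ->; exists 0; rewrite !rmorph0.
have bad_step i : bad i -> exists (i' : 'I_m) (l : nat) (z : int),
    [/\ bad i', (0 < l)%N & root (map_poly iota (sigmap l (p i'))) (iq z * beta i)].
  move=> bi; have [i' [l [z [l0 r]]]] := pole_shift p0 rp L0 Lf (bad_neq0 i bi).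
  (* If beta_{i'} were a constant b, then X - b, which sigma fixes, would be a multiple of
     sigma^l(p_{i'}); hence q^z beta_i = b, and beta_i would be the constant q^(-z) b. *)
  exists i', l, z; split=> // -[b bE]; apply: bi; exists (q ^ (- z) * b).
  have /(pmin i') dp : root (map_poly iota ('X - (cst b)%:P)) (beta i').
    by rewrite map_polyXsubC root_XsubC bE.
  have {dp} : sigmap l (p i') %| sigmap l ('X - (cst b)%:P).
    by elim: (l) => //= l' IH; rewrite dvdp_map.
  have -> : sigmap l ('X - (cst b)%:P) = 'X - (cst b)%:P.
    by elim: (l) => //= l' ->; rewrite map_polyXsubC /= sigma_cst.
  rewrite -(dvdp_map iota) => /dvdpP[u uE].
  have : root (map_poly iota ('X - (cst b)%:P)) (iq z * beta i).
    by rewrite uE rootM r orbT.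
  rewrite map_polyXsubC root_XsubC => /eqP bz.
  rewrite !rmorphM -bz -/(iq _) mulrA [iq (- z)]iqE [iq z]iqE -expfzDr //.
  by rewrite addNr expr0z mul1r.
apply: contrapT => /(introT (asboolP (bad i0))) bad0.
(* Maximality provides the size bound of [shift_coefs_constant_ratio], which then forces equal sizes
   at each [bad_step]. *)
pose i1 := [arg max_(i > i0 | `[< bad i >]) size (p i)].
have [b1 max1] : bad i1 /\ forall i, bad i -> (size (p i) <= size (p i1))%N.
  rewrite /i1; case: arg_maxnP => // i /asboolP bi H; split=> // j bj.
  by apply: H; apply/asboolP.
(* Sigma fixes constants, so along a chain the ratios multiply and the exponents l add up: R is
   transitive. *)
pose R i i' := exists2 l, (0 < l)%N & forall j, exists c : k,
  iter l sigma (p i')`_j = cst c * (p i)`_j.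
have [||i [[bi _] [l l0 lE]]] := @exists_reflexive _
    (fun i => bad i /\ size (p i) = size (p i1)) R _ _ i1 (conj b1 erefl).
- move=> x y z [l l0 lE] [l' l0' lE']; exists (l + l')%N; first by rewrite addn_gt0 l0.
  move=> j; have [d dE] := lE j; have [d' dE'] := lE' j; exists (d' * d).
  rewrite iterD dE'; have -> : forall u, iter l sigma (cst d' * u) = cst d' * iter l sigma u.
    by move=> u; elim: (l) => //= s ->; rewrite rmorphM /= sigma_cst.
  by rewrite dE mulrA rmorphM.
- move=> x [bx sx]; have [y [l [z [by_ l0 r]]]] := bad_step x bx.
  have le_yx : (size (p y) <= size (p x))%N by rewrite sx max1.
  have [sy lE] := shift_coefs_constant_ratio (pm x) (pm y) le_yx (pmin x) r.
  by exists y; split; [rewrite sy|exists l].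
apply: bi; apply: (root_constant_coefs (p0 i) _ (rp i)) => j.
(* [lE] is the loop [R i i]: each coefficient of p_i is multiplied by a constant under sigma^l,
   hence is itself constant. *)
have [d dE] := lE j; exact: sigma_eigen l0 dE.
Qed.

(** With p_i = X - b_i the common denominator is fixed by sigma, so [exists_annihilator] gives L(f)
    = 0, and g = 0 works. *)
Lemma telescoper_of_constant_poles :
  (forall i : 'I_m, exists b : k, beta i = iota (cst b)) ->
  exists L : {poly E}, exists g : ratF E, L != 0 /\ skew_act sigma L f = dilate (cst q) g - g.
Proof.
move=> /fin_all_exists[b bE].
have [||A fE] := @common_denominator (fun i => 'X - (cst (b i))%:P).
- by move=> i; rewrite polyXsubC_eq0.
- by move=> i; rewrite map_polyXsubC root_XsubC bE.
have [|L L0 LE] := @exists_annihilator _ sigma A (\prod_i ('X - (cst (b i))%:P) ^+ n i).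
  rewrite rmorph_prod; apply: eq_bigr => i _.
  by rewrite rmorphXn /= map_polyXsubC /= sigma_cst.
by exists L, 0; rewrite fE LE dilate0 ?subrr ?fmorph_eq0.
Qed.

End Telescoping.

Theorem theorem4p14
    (k : closedFieldType) (char_k : [pchar k] =i pred0)
    (q : k) (q_neq0 : q != 0) (q_nroot : forall i : int, i != 0 -> q ^ i != 1)
    (K : closedFieldType) (iota : {rmorphism ratF k -> K})
    (K_alg : forall z : K, algebraicOver iota z)
    (f : ratF (ratF k)) (c : ratF k)
    (m : nat) (n : 'I_m -> nat) (n_gt0 : forall i, (0 < n i)%N)
    (alpha : 'I_m -> nat -> K) (beta : 'I_m -> K)
    (f_def : ratF_ext iota f =
       (iota c)%:P%:F +
       \sum_(i < m) \sum_(1 <= j < (n i).+1)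
          (alpha i j)%:P%:F / ('X - (beta i)%:P)%:F ^+ j)
    (alpha_neq0 : forall i, alpha i (n i) != 0)
    (beta_orbits : forall (i i' : 'I_m) (z : int),
       i != i' -> beta i <> iota (q ^ z)%:P%:F * beta i') :
  (exists L : shift_op k, exists g : ratF (ratF k),
      L != 0 /\ op_act L f = delta_qx q g)
  <-> (forall i : 'I_m, exists b : k, beta i = iota b%:P%:F).
Proof.
pose cst : {rmorphism k -> ratF k} := @FracField.tofrac _ \o polyC.
have eigen l b u := @iter_shift_eigen k char_k l b u.
(* For E = k(t) both equations unfold to the same term, so conversion proves the equality. *)
have actE (L : shift_op k) (g : ratF (ratF k)) :
    (op_act L f = delta_qx q g) = (skew_act (@shift k) L f = dilate (cst q) g - g).
  by [].
split=> [[L [g [L0]]]|bE].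
  rewrite actE => Lf.
  exact: (constant_poles (@shiftNK k) (@shiftC k : forall b, shift (cst b) = cst b)
    eigen q_neq0 q_nroot K_alg n_gt0 f_def alpha_neq0 beta_orbits L0 Lf).
have [L [g [L0 Lf]]] := telescoper_of_constant_poles
  (@shiftC k : forall b, shift (cst b) = cst b) q_neq0 f_def bE.
exists L, g; split; first exact: L0.
by rewrite actE; exact: Lf.
Qed.
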